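(* Let $G$ be an Abelian group. A function $f:G\to\mathbb{C}$ is a local polynomial if and only if for each positive integer $t$ and all elements $g_1,g_2,\dots,g_t$ in $G$ there are natural numbers $n_1,\dots,n_t$ such that $$\Delta_{g_i}^{n_i+1}*f(x)=0$$ holds for $i=1,2,\dots,t$ and for all $x$ in the subgroup of $G$ generated by $g_1,\dots,g_t$.
   Context: Natural numbers include $0$. For an Abelian group $G$ (written additively), $\mathbb{C}G$ is the algebra of finitely supported complex valued functions on $G$ with convolution $\mu*\nu(x)=\sum_{y\in G}\mu(x-y)\nu(y)$; $\delta_y$ is the characteristic function of $\{y\}$. The algebra acts on all functions $f:G\to\mathbb{C}$ by $\mu*f(x)=\sum_{y\in G} f(x-y)\mu(y)$. The difference with increment $y\in G$ is $\Delta_y=\delta_{-y}-\delta_0$, so that $\Delta_y*f(x)=f(x+y)-f(x)$, and $\Delta_y^{m}$ is the $m$-fold convolution power of $\Delta_y$. An additive function on an Abelian group $H$ is a homomorphism $a:H\to(\mathbb{C},+)$. A function $p:H\to\mathbb{C}$ is a polynomial if it belongs to the function algebra generated by the additive functions and the constants, i.e. $p(x)=P(a_1(x),\dots,a_n(x))$ for all $x\in H$, where $a_1,\dots,a_n:H\to\mathbb{C}$ are additive and $P:\mathbb{C}^n\to\mathbb{C}$ is an ordinary complex polynomial in $n$ variables. A function $f:G\to\mathbb{C}$ is a local polynomial if its restriction to every finitely generated subgroup $H$ of $G$ is a polynomial on $H$. *)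

(* Defs.v *)
From HB Require Import structures.
From mathcomp Require Import all_boot all_order all_algebra.
From mathcomp Require Import finmap monalg boolp.
(* Not imported: its notations clash with those of monalg. *)
From mathcomp Require mpoly.

Set Implicit Arguments.
Unset Strict Implicit.
Unset Printing Implicit Defensive.

Import GRing.Theory.

Local Open Scope ring_scope.

(* Subgroups of G are the bundled predicates [zmodClosed G]; each one is made
   into an abelian group in its own right. *)
Section Subgroup.
Variables (G : zmodType) (H : zmodClosed G).

Record subgroup : predArgType :=
  Subgroup { subgroup_val : G; _ : subgroup_val \in H }.

HB.instance Definition _ := [isSub for subgroup_val].
HB.instance Definition _ := [Choice of subgroup by <:].
HB.instance Definition _ := [SubChoice_isSubZmodule of subgroup by <:].

End Subgroup.

Definition gen_subgroup (G : zmodType) (s : seq G) : {pred G} :=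
  fun x => `[< forall H : zmodClosed G, {subset s <= H} -> x \in H >].

Section Generated.
Variables (G : zmodType) (s : seq G).

Fact gen_subgroup_zmod_closed : zmod_closed (gen_subgroup s).
Proof.
split=> [|x y /asboolP xs /asboolP ys]; apply/asboolP => H sH; first exact: rpred0.
by apply: rpredB; [apply: xs | apply: ys].
Qed.

HB.instance Definition _ :=
  GRing.isZmodClosed.Build G (gen_subgroup s) gen_subgroup_zmod_closed.
End Generated.

Definition finitely_generated (G : zmodType) (H : zmodClosed G) : Prop :=
  exists s : seq G, H =i gen_subgroup s.

Definition is_polynomial (C : comNzRingType) (H : zmodType) (p : H -> C) : Prop :=
  exists (n : nat) (a : 'I_n -> {additive H -> C}) (P : mpoly.mpoly n C),
    forall x, p x = mpoly.meval (fun i => a i x) P.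

Definition local_polynomial (C : comNzRingType) (G : zmodType) (f : G -> C) :
    Prop :=
  forall H : zmodClosed G, finitely_generated H ->
    is_polynomial (fun x : subgroup H => f (val x)).

Section GroupAlgebra.
Variables (C : comNzRingType) (G : zmodType).

(* [{malg C[G]}] is the module of finitely supported functions G -> C, and
   [<< y >>] is the characteristic function of {y}. The ring structure that
   monalg puts on it is unavailable here: it requires a monoid of exponents
   whose only unit is the identity. *)
Definition conv (mu nu : {malg C[G]}) : {malg C[G]} :=
  [malg x in [fset (a + b)%R | a in msupp mu, b in msupp nu]%fset =>
     \sum_(y <- msupp nu) mu@_(x - y) * nu@_y].

(* The domain restriction in [conv] only discards zero values. *)
Lemma convE (mu nu : {malg C[G]}) (x : G) :
  (conv mu nu)@_x = \sum_(y <- msupp nu) mu@_(x - y) * nu@_y.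
Proof.
rewrite mcoeffE; case: ifPn => // xNab; rewrite big_seq big1 // => y y_nu.
rewrite mcoeff_outdom ?mul0r //; apply: contra xNab => xy_mu.
by rewrite -[x](subrK y) in_imfset2.
Qed.

Definition conv_exp (mu : {malg C[G]}) (m : nat) : {malg C[G]} :=
  iter m (conv mu) << (0 : G) >>.

Definition conv_act (mu : {malg C[G]}) (f : G -> C) (x : G) : C :=
  \sum_(y <- msupp mu) f (x - y) * mu@_y.

Definition Delta (y : G) : {malg C[G]} := << - y >> - << (0 : G) >>.

Lemma act_Delta (y : G) (f : G -> C) (x : G) :
  conv_act (Delta y) f x = f (x + y) - f x.
Proof.
have actE (D : {fset G}) (mu : {malg C[G]}) : (msupp mu `<=` D)%fset ->
    conv_act mu f x = \sum_(z <- D) f (x - z) * mu@_z.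
  move=> sD; rewrite /conv_act; apply: big_fset_incl => // z _ zN.
  by rewrite mcoeff_outdom ?mulr0.
have U1 (z : G) : conv_act << z >> f x = f (x - z).
  rewrite (actE [fset z]%fset) ?big_seq_fset1 ?mcoeffUU ?mulr1 //.
  exact: msuppU_le.
rewrite (actE _ _ (@msuppB_le _ _ << - y >> << (0 : G) >>)).
under eq_bigr do rewrite mcoeffB mulrBr.
rewrite sumrB -(actE _ _ (fsubsetUl _ _)) -(actE _ _ (fsubsetUr _ _)) !U1.
by rewrite opprK subr0.
Qed.

End GroupAlgebra.

Arguments Delta C {G} y.

(* Main.v *)
Require Import Defs.
From HB Require Import structures.
From mathcomp Require Import all_boot all_order all_algebra.
From mathcomp Require Import complex.
From mathcomp Require Import reals.
From mathcomp Require Import ring.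
From mathcomp Require Import finmap monalg boolp.
From mathcomp Require mpoly.
Import (canonicals) mpoly.

(** Both conditions only see finitely generated subgroups, so let H be generated
    by g_1, ..., g_t, and let D_y be the difference operator with increment y.

    On H, the functions killed by some power of D_y form an algebra: sums are
    clear, and products follow from the Leibniz rule
    [D(pq) = Dp q + p Dq + Dp Dq] by induction on the sum of the exponents
    ([diff_nilpotentM]). Constants and additive functions belong to it, hence
    so do all polynomials ([is_polynomial_diff_nilpotent]).

    Conversely, let f be killed on H by a power of each D_{g_i}. The proof goes
    by induction on the number of generators, for all f at once, adjoining one
    generator g to a subgroup K; difference operators commute, so every
    D_g^j f is killed by powers of the D_{g_i} too and is a polynomial on K by
    induction. Two cases arise.

    - No nonzero multiple of g lies in K ([is_polynomial_free]). Then H is the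
      direct sum of K and Zg, and Newton's formula expands f(h + kg) as the
      finite sum of the [binomial(k, j) (D_g^j f)(h)]. This is a polynomial on
      H, because the projections to K and to the coordinate k are additive.

    - Some multiple ng with n > 0 lies in K ([is_polynomial_torsion]). Since
      the complex numbers form a divisible torsion-free group, additive
      functions extend from K to H, so there is a polynomial q on H that agrees
      with f on K. By the first half, a power of D_g kills q and hence f - q.
      For h in K, Newton's formula thus makes (f - q)(h + kg) a polynomial in
      k, and it vanishes at all multiples of n; so it is zero and f = q. *)

Set Implicit Arguments.
Unset Strict Implicit.
Unset Printing Implicit Defensive.

Import GRing.Theory.
Local Open Scope ring_scope.

(** * Iterated differences *)

Section Difference.
Variables (C : comNzRingType) (H : zmodType).
Implicit Types (f g : H -> C) (x y z : H).

Definition diff y f x : C := f (x + y) - f x.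

Definition diff_nilpotent y f := exists m, forall x, iter m (diff y) f x = 0.

Lemma iter_diffD y f g m :
  iter m (diff y) (fun x => f x + g x) =
  fun x => iter m (diff y) f x + iter m (diff y) g x.
Proof.
by elim: m => //= m ->; apply/funext => x; rewrite /diff opprD addrACA.
Qed.

Lemma iter_diff0 y m x : iter m (diff y) (fun=> 0) x = 0.
Proof. by elim: m x => //= m IHm x; rewrite /diff !IHm subr0. Qed.

Lemma diff_comm y z f : diff y (diff z f) = diff z (diff y f).
Proof.
apply/funext => x; rewrite /diff !opprB (addrAC x y z).
by rewrite [LHS]addrACA [RHS]addrACA (addrC (- f (x + y))).
Qed.

Lemma iter_diff_comm y z f m n :
  iter m (diff y) (iter n (diff z) f) = iter n (diff z) (iter m (diff y) f).
Proof.
elim: m => //= m ->; elim: n => //= n <-; exact: diff_comm.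
Qed.

Lemma iter_diff_ge y f m n : (m <= n)%N ->
  (forall x, iter m (diff y) f x = 0) -> forall x, iter n (diff y) f x = 0.
Proof.
move=> /subnK <- f0 x; rewrite iterD.
by have -> : iter m (diff y) f = fun=> 0; [apply/funext | exact: iter_diff0].
Qed.

Lemma iter_diff_vanish (S : zmodClosed H) y f m : y \in S ->
  {in S, forall x, f x = 0} -> {in S, forall x, iter m (diff y) f x = 0}.
Proof.
move=> yS f0; elim: m => //= m IHm x xS.
by rewrite /diff !IHm ?subrr // rpredD.
Qed.

Lemma diff_nilpotent_diff y f :
  diff_nilpotent y (diff y f) -> diff_nilpotent y f.
Proof. by case=> m f0; exists m.+1 => x; rewrite iterSr. Qed.

Lemma diff_nilpotent_cst y (c : C) : diff_nilpotent y (fun=> c).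
Proof. by exists 1%N => x; rewrite /= /diff subrr. Qed.

Lemma diff_nilpotent_additive y (a : {additive H -> C}) : diff_nilpotent y a.
Proof.
apply: diff_nilpotent_diff.
suff -> : diff y a = fun=> a y by apply: diff_nilpotent_cst.
by apply/funext => x; rewrite /diff raddfD addrC addKr.
Qed.

Lemma diff_nilpotentD y f g : diff_nilpotent y f -> diff_nilpotent y g ->
  diff_nilpotent y (fun x => f x + g x).
Proof.
move=> [m f0] [n g0]; exists (maxn m n) => x; rewrite iter_diffD.
by rewrite (iter_diff_ge _ f0) ?(iter_diff_ge _ g0) ?leq_maxl ?leq_maxr ?addr0.
Qed.

Lemma diffM y f g : diff y (fun x => f x * g x) =
  fun x => diff y f x * g x + f x * diff y g x + diff y f x * diff y g x.
Proof. by apply/funext => x; rewrite /diff; ring. Qed.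

(** The three terms of the Leibniz rule are products for which the sum of the
    exponents has dropped. *)
Lemma diff_nilpotentM y f g : diff_nilpotent y f -> diff_nilpotent y g ->
  diff_nilpotent y (fun x => f x * g x).
Proof.
move=> [m f0] [n g0]; have [k] := ubnP (m + n).
elim: k m n f g f0 g0 => // k IHk [|m] n f g f0 g0 mn_lt.
  by exists 0%N => x /=; rewrite [f x]f0 mul0r.
case: n g0 mn_lt => [|n] g0 mn_lt.
  by exists 0%N => x /=; rewrite [g x]g0 mulr0.
have f0' x : iter m (diff y) (diff y f) x = 0 by rewrite -iterSr.
have g0' x : iter n (diff y) (diff y g) x = 0 by rewrite -iterSr.
apply: diff_nilpotent_diff; rewrite diffM.
rewrite addnS ltnS in mn_lt.
apply: diff_nilpotentD; first apply: diff_nilpotentD.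
- by apply: (IHk m n.+1) => //; rewrite addnS -addSn.
- by apply: (IHk m.+1 n).
- by apply: (IHk m n) => //; apply: leq_trans mn_lt; rewrite addSn.
Qed.

End Difference.

(** For an inclusion [phi] this says that differences along a subgroup can be
    computed in the ambient group. *)
Lemma iter_diff_comp (C : comNzRingType) (K H : zmodType)
    (phi : {additive K -> H}) (f : H -> C) (y : K) m x :
  iter m (diff y) (fun z => f (phi z)) x = iter m (diff (phi y)) f (phi x).
Proof. by elim: m x => //= m IHm x; rewrite /diff !IHm raddfD. Qed.

Section ConvolutionAction.
Variables (C : comNzRingType) (G : zmodType).

(** Both sides are the sum of [f (x - a - y) * mu@_a * nu@_y] over the two
    supports; on the left it is indexed by [z = a + y] and [y]. *)
Lemma conv_act_conv (mu nu : {malg C[G]}) (f : G -> C) (x : G) :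
  conv_act (conv mu nu) f x = conv_act mu (conv_act nu f) x.
Proof.
pose D := [fset (a + b)%R | a in msupp mu, b in msupp nu]%fset.
rewrite /conv_act (@big_fset_incl _ _ _ _ _ D); first last.
- by move=> z _ zN; rewrite mcoeff_outdom ?mulr0.
- apply/fsubsetP => z; rewrite -mcoeff_neq0 mcoeffE -/D.
  by case: ifP => //; rewrite eqxx.
under eq_bigr do rewrite convE mulr_sumr.
under [RHS]eq_bigr do rewrite mulr_suml.
rewrite exchange_big [RHS]exchange_big /= [LHS]big_seq [RHS]big_seq.
apply: eq_bigr => y y_nu.
(* For fixed y, only the z in y + supp mu contribute. *)
pose E := [fset (a + y)%R | a in msupp mu]%fset.
rewrite -(@big_fset_incl _ _ _ _ E D); first last.
- move=> z _ zNE; rewrite [mu@_ _]mcoeff_outdom ?mul0r ?mulr0 //.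
  apply: contra zNE => zy_mu; apply/imfsetP; exists (z - y) => //=.
  by rewrite subrK.
- apply/fsubsetP => z /imfsetP[a /= a_mu ->].
  by rewrite in_imfset2.
rewrite big_imfset /=; last by move=> a b _ _; apply: addIr.
by apply: eq_bigr => a _; rewrite addrK opprD addrA mulrA mulrAC.
Qed.

Lemma conv_act_exp_Delta (y : G) m (f : G -> C) (x : G) :
  conv_act (conv_exp (Delta C y) m) f x = iter m (diff y) f x.
Proof.
elim: m x => [|m IHm] x.
  rewrite /conv_act /= (@big_fset_incl _ _ _ _ _ [fset (0 : G)]%fset).
  - by rewrite big_seq_fset1 mcoeffUU mulr1 subr0.
  - exact: msuppU_le.
  - by move=> z _ zN; rewrite mcoeff_outdom ?mulr0.
rewrite /= conv_act_conv act_Delta /diff.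
by rewrite !IHm.
Qed.

End ConvolutionAction.

(** * The algebra of polynomials *)

Section PolynomialAlgebra.
Variables (C : comNzRingType) (H : zmodType).

Lemma meval_closed (A : (H -> C) -> Prop) :
    (forall c, A (fun=> c)) ->
    (forall f g, A f -> A g -> A (fun x => f x + g x)) ->
    (forall f g, A f -> A g -> A (fun x => f x * g x)) ->
  forall n (a : 'I_n -> H -> C) (P : mpoly.mpoly n C),
    (forall i, A (a i)) -> A (fun x => mpoly.meval (fun i => a i x) P).
Proof.
move=> Ac AD AM n a P Aa.
have AX f m : A f -> A (fun x => f x ^+ m).
  move=> Af; elim: m => [|m IHm]; first exact: Ac.
  by under eq_fun do rewrite exprS; apply: AM.
have Aprod (I : Type) (r : seq I) F :
    (forall i, A (F i)) -> A (fun x => \prod_(i <- r) F i x).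
  move=> AF; elim: r => [|i r IHr].
    by under eq_fun do rewrite big_nil; apply: Ac.
  by under eq_fun do rewrite big_cons; apply: AM.
have Asum (I : Type) (r : seq I) F :
    (forall i, A (F i)) -> A (fun x => \sum_(i <- r) F i x).
  move=> AF; elim: r => [|i r IHr].
    by under eq_fun do rewrite big_nil; apply: Ac.
  by under eq_fun do rewrite big_cons; apply: AD.
under eq_fun do rewrite mpoly.mevalE.
by apply: Asum => m; apply: (AM (fun=> _)) => //; apply: Aprod => i; apply: AX.
Qed.

Lemma is_polynomial_diff_nilpotent (p : H -> C) y :
  is_polynomial p -> diff_nilpotent y p.
Proof.
move=> [n [a [P /funext ->]]].
apply: (meval_closed (A := diff_nilpotent y)).
- exact: diff_nilpotent_cst.
- exact: diff_nilpotentD.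
- exact: diff_nilpotentM.
- by move=> i; apply: diff_nilpotent_additive.
Qed.

Lemma is_polynomial_cst (c : C) : is_polynomial (fun _ : H => c).
Proof.
exists 0%N, (fun=> [the {additive H -> C} of (\0 : H -> C)]).
exists (mpoly.mpolyC 0 c).
by move=> x; rewrite mpoly.mevalC.
Qed.

Lemma is_polynomial_additive (a : {additive H -> C}) : is_polynomial a.
Proof.
exists 1%N, (fun=> a), (mpoly.mpolyX C (mpoly.mnm1 ord0)).
by move=> x; rewrite mpoly.mevalXU.
Qed.

(** Concatenating the two families of additive functions, so that sums and
    products can be taken among polynomials in the same variables. *)
Lemma common_coordinates (p q : H -> C) :
    is_polynomial p -> is_polynomial q ->
  exists n (a : 'I_n -> {additive H -> C}) (P Q : mpoly.mpoly n C),
    (forall x, p x = mpoly.meval (fun i => a i x) P) /\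
    (forall x, q x = mpoly.meval (fun i => a i x) Q).
Proof.
move=> [m [a [P pE]]] [n [b [Q qE]]].
pose X i : mpoly.mpoly (m + n) C := mpoly.mpolyX C (mpoly.mnm1 i).
exists (m + n)%N, (fun i => match split i with inl j => a j | inr k => b k end).
exists (mpoly.comp_mpoly [tuple X (lshift n j) | j < m] P).
exists (mpoly.comp_mpoly [tuple X (rshift m j) | j < n] Q).
split=> x; rewrite mpoly.comp_mpoly_meval ?pE ?qE; apply: mpoly.meval_eq => i;
  rewrite tnth_mktuple mpoly.mevalXU.
  by rewrite -[lshift n i]/(unsplit (inl i)) unsplitK.
by rewrite -[rshift m i]/(unsplit (inr i)) unsplitK.
Qed.

Lemma is_polynomialD (p q : H -> C) : is_polynomial p -> is_polynomial q ->
  is_polynomial (fun x => p x + q x).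
Proof.
move=> pp /(common_coordinates pp)[n [a [P [Q [pE qE]]]]].
by exists n, a, (P + Q) => x; rewrite mpoly.mevalD pE qE.
Qed.

Lemma is_polynomialM (p q : H -> C) : is_polynomial p -> is_polynomial q ->
  is_polynomial (fun x => p x * q x).
Proof.
move=> pp /(common_coordinates pp)[n [a [P [Q [pE qE]]]]].
by exists n, a, (P * Q) => x; rewrite mpoly.mevalM pE qE.
Qed.

Lemma is_polynomial_sum n (p : 'I_n -> H -> C) :
  (forall i, is_polynomial (p i)) -> is_polynomial (fun x => \sum_i p i x).
Proof.
elim: n p => [|n IHn] p pp.
  by under eq_fun do rewrite big_ord0; apply: is_polynomial_cst.
under eq_fun do rewrite big_ord_recr /=.
by apply: is_polynomialD => //; apply: (IHn (fun i => p (widen_ord _ i))).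
Qed.

Lemma is_polynomial_horner (b : {poly C}) (p : H -> C) :
  is_polynomial p -> is_polynomial (fun x => b.[p x]).
Proof.
move=> pp; elim/poly_ind: b => [|b c IHb].
  by under eq_fun do rewrite horner0; apply: is_polynomial_cst.
under eq_fun do rewrite hornerMXaddC.
apply: is_polynomialD; last exact: is_polynomial_cst.
exact: is_polynomialM.
Qed.

End PolynomialAlgebra.

Lemma is_polynomial_comp (C : comNzRingType) (K H : zmodType)
    (phi : {additive K -> H}) (p : H -> C) :
  is_polynomial p -> is_polynomial (fun x => p (phi x)).
Proof.
move=> [n [a [P pE]]].
by exists n, (fun i => [the {additive K -> C} of a i \o phi]), P => x.
Qed.

(** * Newton's interpolation formula *)

Section Newton.
Variable C : numFieldType.

Fixpoint binomial_poly j : {poly C} :=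
  if j is i.+1 then i.+1%:R^-1 *: (binomial_poly i * ('X - i%:R%:P)) else 1.

Lemma binomial_polyS j (x : C) : (binomial_poly j.+1).[x] =
  (binomial_poly j).[x] * (x - j%:R) / j.+1%:R.
Proof. by rewrite /= hornerZ hornerM hornerXsubC mulrC. Qed.

Lemma binomial_poly_pascal j (x : C) :
  (binomial_poly j.+1).[x + 1] =
  (binomial_poly j.+1).[x] + (binomial_poly j).[x].
Proof.
elim: j => [|j IHj]; first by rewrite !binomial_polyS !hornerE !subr0 !divr1.
have nz n : n.+1%:R != 0 :> C by rewrite Num.Theory.pnatr_eq0.
rewrite binomial_polyS IHj [(binomial_poly j.+2).[x]]binomial_polyS.
apply: (mulIf (nz j.+1)); rewrite [RHS]mulrDl !divfK //.
have -> : x + 1 - j.+1%:R = x - j%:R by rewrite -natr1; ring.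
rewrite mulrDl.
have -> : (binomial_poly j).[x] * (x - j%:R) =
    (binomial_poly j.+1).[x] * j.+1%:R.
  by rewrite binomial_polyS divfK.
by rewrite -[j.+2%:R]natr1; ring.
Qed.

Lemma binomial_poly_at0 j : (binomial_poly j).[0] = (j == 0)%:R.
Proof.
elim: j => [|[|j] IHj]; first by rewrite /= hornerE.
  by rewrite binomial_polyS subrr mulr0 mul0r.
by rewrite binomial_polyS IHj /= !mul0r.
Qed.

Lemma eq_int_of_diff (u v : int -> C) : u 0 = v 0 ->
  (forall k, u (k + 1) - u k = v (k + 1) - v k) -> u =1 v.
Proof.
move=> uv0 uvS; elim/int_ind => [|n IHn|n IHn] //.
  by have := uvS n; rewrite IHn addrC [in RHS]addrC intS [1 + _]addrC => /addrI.
have := uvS (- n.+1%:Z).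
by rewrite intS opprD addrAC addNr add0r IHn => /addrI /oppr_inj.
Qed.

(** Both sides agree at [k = 0], and by Pascal's rule their differences in [k]
    are the two sides of the same formula for [diff y f], which is killed one
    step earlier. *)
Lemma newton_interpolation (H : zmodType) (f : H -> C) y m x k :
    (forall z, iter m (diff y) f z = 0) ->
  f (x + y *~ k) =
  \sum_(j < m) (binomial_poly j).[k%:~R] * iter j (diff y) f x.
Proof.
elim: m f k => [|m IHm] f k f0; first by rewrite big_ord0 [LHS]f0.
move: k; apply: eq_int_of_diff => [|k].
  rewrite mulr0z addr0 big_ord_recl big1 => [|i _].
    by rewrite /= !hornerE.
  by rewrite binomial_poly_at0 mul0r.
transitivity (diff y f (x + y *~ k)).
  by rewrite /diff mulrzDr mulr1z addrA.
rewrite IHm => [|z]; last by rewrite -iterSr.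
rewrite -sumrB big_ord_recl /= !hornerE subrr add0r.
apply: eq_bigr => i _.
by rewrite -mulrBl intrD binomial_poly_pascal [X in X - _]addrC addrK -iterSr.
Qed.

Lemma poly_eq0_multiples (p : {poly C}) n : (0 < n)%N ->
  (forall m, p.[(n * m)%:R] = 0) -> p = 0.
Proof.
move=> n_gt0 p0; apply/eqP; apply/negPn/negP => pN0.
have := max_poly_roots pN0 (rs := [seq (n * m)%:R | m <- iota 0 (size p)]).
rewrite size_map size_iota ltnn => F; apply/notF/F.
  by apply/allP => _ /mapP[m _ ->]; apply/eqP/p0.
rewrite map_inj_uniq ?iota_uniq // => i j /eqP.
by rewrite Num.Theory.eqr_nat eqn_pmul2l // => /eqP.
Qed.

(** By Newton's formula, [u] along a coset of the multiples of [y] is a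
    polynomial in the coefficient; in characteristic 0 it has too many roots. *)
Lemma diff_nilpotent_eq0 (H : zmodType) (u : H -> C) y x n :
    (0 < n)%N -> diff_nilpotent y u -> (forall m, u (x + y *+ (n * m)) = 0) ->
  forall k, u (x + y *~ k) = 0.
Proof.
move=> n_gt0 [m u0] ux0 k.
pose p := \sum_(j < m) iter j (diff y) u x *: binomial_poly j.
have pE l : u (x + y *~ l) = p.[l%:~R].
  rewrite (newton_interpolation _ _ u0) horner_sum.
  by apply: eq_bigr => j _; rewrite hornerZ mulrC.
rewrite pE (@poly_eq0_multiples p n) ?horner0 // => l.
by rewrite -[RHS](ux0 l) (pmulrn y) pE -pmulrn.
Qed.

End Newton.

(** * Adjoining one generator *)

Section CyclicExtension.
Variables (K H : zmodType) (iota : {additive K -> H}) (g : H).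
Hypothesis generated : forall x, exists hk, x = iota hk.1 + g *~ hk.2.

(** The extension of [a] that sends [g] to [c]: the formula for [b] does not
    depend on how an element is written exactly when [a] and [c] agree on the
    multiples of [g] that come from [K]. The target is any group, so that
    projections onto the two summands are obtained as well. *)
Lemma additive_extension (V : zmodType) (a : {additive K -> V}) (c : V) :
    (forall h k, iota h = g *~ k -> a h = c *~ k) ->
  exists b : {additive H -> V}, forall h k, b (iota h + g *~ k) = a h + c *~ k.
Proof.
move=> compat; have [eta etaE] := choice generated.
pose b x := a (eta x).1 + c *~ (eta x).2.
have bE h k : b (iota h + g *~ k) = a h + c *~ k.
  rewrite /b; move: (eta _) (etaE (iota h + g *~ k)) => [h' k'] /= eq_hk.
  have /compat : iota (h' - h) = g *~ (k - k').
    rewrite raddfB mulrzBr; apply/eqP; rewrite subr_eq addrAC eq_sym subr_eq.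
    by rewrite addrC eq_hk.
  rewrite raddfB mulrzBr => E.
  by rewrite -[a h'](subrK (a h)) E addrAC subrK addrC.
have bB : zmod_morphism b.
  move=> x y; rewrite [in LHS](etaE x) [in LHS](etaE y) opprD addrACA.
  by rewrite -raddfB -mulrzBr bE raddfB mulrzBr /b opprD addrACA.
pose bM := GRing.isZmodMorphism.Build H V b bB.
by exists (HB.pack_for {additive H -> V} b bM).
Qed.

Hypothesis iota_inj : injective iota.
Variable C : numFieldType.

(** Each additive coordinate [a] extends because [C] is divisible: with
    [h0 = n g] the value at [g] has to be [a h0 / n]. *)
Lemma is_polynomial_extension (h0 : K) n (p : K -> C) : (0 < n)%N ->
    iota h0 = g *+ n -> is_polynomial p ->
  exists2 q : H -> C, is_polynomial q & forall h, q (iota h) = p h.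
Proof.
move=> n_gt0 h0E [d [a [P pE]]].
have /fin_all_exists[b bE] i : exists b : {additive H -> C},
    forall h, b (iota h) = a i h.
  have [h k hE|b bE] := @additive_extension C (a i) (a i h0 / n%:R).
    have nz : n%:R != 0 :> C by rewrite Num.Theory.pnatr_eq0 -lt0n.
    have : h *+ n = h0 *~ k.
      by apply: iota_inj; rewrite raddfMn raddfMz hE h0E !pmulrn mulrzAC.
    move=> /(congr1 (a i)); rewrite raddfMn raddfMz => E.
    by apply: (mulIf nz); rewrite mulrzAl divfK // mulr_natr.
  by exists b => h; have := bE h 0; rewrite !mulr0z !addr0.
exists (fun x => mpoly.meval (fun i => b i x) P); first by exists d, b, P.
by move=> h; rewrite pE; apply: mpoly.meval_eq => i; apply: bE.
Qed.

(** The difference between [f] and the extension of its restriction vanishes at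
    the points [h + k g] with [n] dividing [k], hence at all of them. *)
Lemma is_polynomial_torsion (f : H -> C) (h0 : K) n : (0 < n)%N ->
    iota h0 = g *+ n -> diff_nilpotent g f ->
  is_polynomial (fun h => f (iota h)) -> is_polynomial f.
Proof.
move=> n_gt0 h0E f_nil fp.
have [q qp qE] := is_polynomial_extension n_gt0 h0E fp.
pose u x := f x + -1 * q x.
have u_nil : diff_nilpotent g u.
  apply: diff_nilpotentD => //; apply: diff_nilpotentM.
    exact: diff_nilpotent_cst.
  exact: is_polynomial_diff_nilpotent.
have u0 h : u (iota h) = 0 by rewrite /u qE mulN1r subrr.
suff -> : f = q by [].
apply/funext => x; apply/eqP; rewrite -subr_eq0 -mulN1r; apply/eqP.
have [[h k] /= ->] := generated x.
apply: (diff_nilpotent_eq0 n_gt0 u_nil) => m.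
by rewrite mulrnA -h0E -raddfMn -raddfD u0.
Qed.

(** Newton's formula, read with the projections [pi] and [kappa] of the direct
    sum, displays [f] as a polynomial expression in known polynomials. *)
Lemma is_polynomial_free (f : H -> C) :
    (forall h k, iota h = g *~ k -> k = 0) -> diff_nilpotent g f ->
  (forall j, is_polynomial (fun h => iter j (diff g) f (iota h))) ->
  is_polynomial f.
Proof.
move=> free [m f0] fp.
have [h k hE|pi piE] := @additive_extension K idfun 0.
  by apply: iota_inj; rewrite hE (free _ _ hE) mulr0z mul0rz raddf0.
have [h k /free -> //|kappa kE] := @additive_extension C (\0 : K -> C) 1.
have -> : f = fun x => \sum_(j < m)
    (binomial_poly C j).[kappa x] * iter j (diff g) f (iota (pi x)).
  apply/funext => x; have [[h k] /= ->] := generated x.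
  rewrite (newton_interpolation _ _ f0); apply: eq_bigr => j _.
  by rewrite piE kE /= add0r mul0rz addr0.
apply: is_polynomial_sum => j; apply: is_polynomialM.
  exact/is_polynomial_horner/is_polynomial_additive.
exact: (is_polynomial_comp pi (fp j)).
Qed.

Lemma is_polynomial_cyclic_extension (f : H -> C) : diff_nilpotent g f ->
  (forall j, is_polynomial (fun h => iter j (diff g) f (iota h))) ->
  is_polynomial f.
Proof.
move=> f_nil fp.
have [[n [n_gt0 [h0 h0E]]]|torsionfree] :=
  pselect (exists n, (0 < n)%N /\ exists h, iota h = g *+ n).
  exact: is_polynomial_torsion n_gt0 h0E f_nil (fp 0%N).
apply: is_polynomial_free => // h [[|k]|k] hE //; case: torsionfree.
  by exists k.+1; split=> //; exists h.
by exists k.+1; split=> //; exists (- h); rewrite raddfN hE NegzE mulrNz opprK.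
Qed.

End CyclicExtension.

(** * Finitely generated subgroups *)

Section Inclusion.
Variables (G : zmodType) (K H : zmodClosed G) (sKH : {subset K <= H}).

Definition subgroup_incl (x : subgroup K) : subgroup H :=
  Subgroup (sKH (valP x)).

Fact subgroup_incl_is_zmod_morphism : zmod_morphism subgroup_incl.
Proof.
by move=> x y; apply: val_inj; rewrite [RHS](raddfB val); exact: (raddfB val).
Qed.

HB.instance Definition _ := GRing.isZmodMorphism.Build
  (subgroup K) (subgroup H) subgroup_incl subgroup_incl_is_zmod_morphism.

End Inclusion.

Section AddCyclic.
Variables (G : zmodType) (K : zmodClosed G) (g : G).

(** The subgroup generated by [K] and [g]. *)
Definition add_cyclic : {pred G} := fun x => `[< exists k, x - g *~ k \in K >].

Fact add_cyclic_zmod_closed : zmod_closed add_cyclic.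
Proof.
split=> [|x y /asboolP[k xk] /asboolP[l yl]]; apply/asboolP.
  by exists 0; rewrite mulr0z subr0 rpred0.
by exists (k - l); rewrite mulrzBr opprD addrACA -opprD rpredB.
Qed.

HB.instance Definition _ :=
  GRing.isZmodClosed.Build G add_cyclic add_cyclic_zmod_closed.

End AddCyclic.

Section Generated.
Variable G : zmodType.
Implicit Types s : seq G.

Lemma mem_gen_subgroup s : {subset s <= gen_subgroup s}.
Proof. by move=> x xs; apply/asboolP => H; apply. Qed.

Lemma gen_subgroup_min s (H : zmodClosed G) :
  {subset s <= H} -> {subset gen_subgroup s <= H}.
Proof. by move=> sH x /asboolP; apply. Qed.

Lemma gen_subgroupS s s' : {subset s <= s'} ->
  {subset gen_subgroup s <= gen_subgroup s'}.
Proof.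
by move=> ss'; apply: gen_subgroup_min => x /ss'; apply: mem_gen_subgroup.
Qed.

Lemma gen_subgroup_nil (x : G) : x \in gen_subgroup (Nil G) -> x = 0.
Proof.
pose zero : {pred G} := fun y => y == 0.
have zero_closed : zmod_closed zero.
  split=> [|y z]; rewrite !unfold_in /zero // => /eqP-> /eqP->.
  by rewrite subrr.
pose zeroM := GRing.isZmodClosed.Build G zero zero_closed.
pose zeroG := HB.pack_for (zmodClosed G) zero zeroM.
by move=> /(@gen_subgroup_min _ zeroG) x0; apply/eqP/x0.
Qed.

Lemma gen_subgroup_cons g s x : x \in gen_subgroup (g :: s) ->
  exists k, x - g *~ k \in gen_subgroup s.
Proof.
move=> xs; apply/asboolP.
apply: (@gen_subgroup_min _ (add_cyclic (gen_subgroup s) g)) xs => y.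
rewrite inE => /predU1P[->|ys]; apply/asboolP.
  by exists 1; rewrite mulr1z subrr rpred0.
by exists 0; rewrite mulr0z subr0 mem_gen_subgroup.
Qed.

(** The induction on generators has to be carried out for all [f]
    simultaneously, since adjoining [g] uses the case of [s] for every iterated
    difference of [f] along [g]. *)
Lemma is_polynomial_gen_subgroup (C : numFieldType) s (f : G -> C) :
    (forall g, g \in s ->
       exists m, {in gen_subgroup s, forall x, iter m (diff g) f x = 0}) ->
  is_polynomial (fun x : subgroup (gen_subgroup s) => f (val x)).
Proof.
elim: s f => [|g s IHs] f f_nil.
  have -> : (fun x : subgroup (gen_subgroup [::]) => f (val x)) = fun=> f 0.
    by apply/funext => x; rewrite (gen_subgroup_nil (valP x)).
  exact: is_polynomial_cst.
have ss' : {subset gen_subgroup s <= gen_subgroup (g :: s)}.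
  by apply: gen_subgroupS => x xs; rewrite inE xs orbT.
have gs : g \in gen_subgroup (g :: s) by rewrite mem_gen_subgroup ?mem_head.
pose g' : subgroup (gen_subgroup (g :: s)) := Subgroup gs.
apply: (@is_polynomial_cyclic_extension _ _ (subgroup_incl ss') g').
- move=> x; have [k xk] := gen_subgroup_cons (valP x).
  exists (Subgroup xk, k); apply: val_inj.
  by rewrite [RHS](raddfD val) (raddfMz val) /= subrK.
- by move=> x y /(congr1 val) /= /val_inj.
- have [|m f0] := f_nil g; first exact: mem_head.
  by exists m => x; rewrite (iter_diff_comp val) f0 ?(valP x).
move=> j; under eq_fun do rewrite (iter_diff_comp val) /=.
apply: IHs => y ys; have [|m f0] := f_nil y; first by rewrite inE ys orbT.
exists m => x xs; rewrite iter_diff_comm.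
by apply: (iter_diff_vanish (S := gen_subgroup (g :: s)) _ gs f0); apply: ss'.
Qed.

End Generated.

(** * Local polynomials *)

Theorem theorem2 (R : realType) (G : zmodType) (f : G -> R[i]) :
  local_polynomial f <->
  forall (t : nat) (g : 'I_t -> G), (0 < t)%N ->
    exists n : 'I_t -> nat,
      forall (i : 'I_t) (x : G), x \in gen_subgroup (codom g) ->
        conv_act (conv_exp (Delta R[i] (g i)) (n i).+1) f x = 0.
Proof.
split=> [fp t g _|f_nil H [s Hs]].
  have g_in i : g i \in gen_subgroup (codom g).
    exact/mem_gen_subgroup/codom_f.
  have {}fp : is_polynomial
      (fun x : subgroup (gen_subgroup (codom g)) => f (val x)).
    by apply: fp; exists (codom g).
  have /fin_all_exists[n nE] i : exists m,
      {in gen_subgroup (codom g), forall x, iter m (diff (g i)) f x = 0}.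
    have [m f0] := is_polynomial_diff_nilpotent (Subgroup (g_in i)) fp.
    by exists m => x xg; have := f0 (Subgroup xg); rewrite (iter_diff_comp val).
  exists n => i x xg; rewrite conv_act_exp_Delta.
  exact: (iter_diff_vanish (S := gen_subgroup (codom g)) 1 (g_in i) (nE i)).
(* Adding 0 as a generator keeps the family nonempty when s is empty. *)
pose g (i : 'I_(size s).+1) := (0 :: s)`_i.
have codom_g : codom g = 0 :: s.
  by rewrite -[RHS](mkseq_nth 0) codomE /mkseq -val_enum_ord -map_comp.
have [//|n nE] := f_nil _ g; rewrite codom_g in nE.
have sH : {subset H <= gen_subgroup (0 :: s)}.
  by move=> x; rewrite Hs; apply: gen_subgroupS => y ys; rewrite inE ys orbT.
apply: (is_polynomial_comp (subgroup_incl sH)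
  (p := fun x : subgroup (gen_subgroup (0 :: s)) => f (val x))).
apply: is_polynomial_gen_subgroup => y; rewrite -codom_g => /codomP[i ->].
exists (n i).+1 => x; rewrite codom_g => /(nE i) <-.
by rewrite conv_act_exp_Delta.
Qed.
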